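(* If a graph $G$ on $[n]$ is compatible with the elimination order $$p_{12}>p_{13}>\cdots>p_{1n}>p_{23}>\cdots>p_{2n}>\cdots>p_{n-2,n}>p_{n-1,n},$$ then the ideal $I_G$ is generated by the quadratic Plücker relations $$p_{ij}p_{kl}-p_{ik}p_{jl}+p_{il}p_{jk},\qquad i<j<k<l,\quad \{\{i,j\},\{k,l\},\{i,k\},\{j,l\},\{i,l\},\{j,k\}\}\subseteq E(G).$$
   Context: Let $\mathbb{K}$ be a field and $S=\mathbb{K}[p_{ij}:1\le i<j\le n]$. The Plücker ideal $I_{L_n}\subset S$ is the kernel of the $\mathbb{K}$-algebra map $S\to\mathbb{K}[x_1,\dots,x_n,y_1,\dots,y_n]$, $p_{ij}\mapsto x_iy_j-x_jy_i$. For a finite simple graph $G$ on $[n]=\{1,\dots,n\}$ with edge set $E(G)$, let $I_G=I_{L_n}\cap\mathbb{K}[p_{ij}:\{i,j\}\in E(G)]$. $G$ is compatible with the elimination order given by the lexicographic order on $S$ with variables ordered as $p_{12}>p_{13}>\cdots>p_{1n}>p_{23}>\cdots>p_{2n}>\cdots>p_{n-2,n}>p_{n-1,n}$ if, for some $n\ge k>j\ge1$, its complement graph $G^c$ is isomorphic to the graph on $[n]$ with edges $\{1,2\},\{1,3\},\dots,\{j,j+1\},\dots,\{j,k\}$, i.e. the edges corresponding to the initial segment from $p_{12}$ to $p_{jk}$ in the list of variables $p_{12},p_{13},\dots,p_{1n},p_{23},\dots,p_{2n},\dots,p_{n-2,n},p_{n-1,n}$: all $\{a,b\}$ with $1\le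 a<b\le n$ and either $a<j$, or $a=j$ and $b\le k$. *)

(* Defs.v *)
From mathcomp Require Import all_boot all_order all_fingroup all_algebra.
From mathcomp Require Import mpoly.

Set Implicit Arguments.
Unset Strict Implicit.
Unset Printing Implicit Defensive.

Import GRing.Theory.
Local Open Scope ring_scope.

(* The vertex set [n] = {1, ..., n} is represented by 'I_n = {0, ..., n-1}.   *)
(* A graph on [n] is a symmetric and irreflexive relation E : rel 'I_n.       *)

Definition compl_graph (n : nat) (E : rel 'I_n) : rel 'I_n :=
  fun a b => (a != b) && ~~ E a b.

Definition graph_iso (n : nat) (E F : rel 'I_n) : Prop :=
  exists s : {perm 'I_n}, forall a b, E a b = F (s a) (s b).

(* For a < b, the variable p_ab lies in the segment from p_12 to p_jk of the  *)
(* list p_12, p_13, ..., p_1n, p_23, ..., p_2n, ..., p_(n-1)n.                *)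
Definition in_segment (n : nat) (j k a b : 'I_n) : bool :=
  (a < b)%N && ((a < j)%N || (a == j) && (b <= k)%N).

Definition segment_graph (n : nat) (j k : 'I_n) : rel 'I_n :=
  fun a b => in_segment j k a b || in_segment j k b a.

Definition elim_compatible (n : nat) (E : rel 'I_n) : Prop :=
  exists j k : 'I_n,
    (j < k)%N /\ graph_iso (compl_graph E) (segment_graph j k).

Notation pvar n := {ij : 'I_n * 'I_n | (ij.1 < ij.2)%N}.

Notation pring K n := {mpoly K[#|{: pvar n}|]}.

(* pl i j is the variable p_ij if i < j; the value 0 for j <= i is junk.      *)
Definition pl (K : fieldType) (n : nat) (i j : 'I_n) : pring K n :=
  if insub (i, j) is Some v then 'X_(enum_rank (v : pvar n)) else 0.

Definition xvar (K : fieldType) (n : nat) (i : 'I_n) : {mpoly K[n + n]} :=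
  'X_(lshift n i).
Definition yvar (K : fieldType) (n : nat) (i : 'I_n) : {mpoly K[n + n]} :=
  'X_(rshift n i).

Definition plucker_map (K : fieldType) (n : nat) (f : pring K n) :
    {mpoly K[n + n]} :=
  mmap (@mpolyC (n + n) K)
    (fun v => let: (i, j) := val (enum_val v) in
       xvar K i * yvar K j - xvar K j * yvar K i) f.

Definition plucker_ideal (K : fieldType) (n : nat) : {pred pring K n} :=
  fun f => plucker_map f == 0.
Arguments plucker_ideal K n : clear implicits.

(* K[p_ij : {i, j} in E], the polynomials all of whose monomials involve only *)
(* variables p_ij with {i, j} in E.                                           *)
Definition edge_subring (K : fieldType) (n : nat) (E : rel 'I_n) :
    {pred pring K n} :=
  fun f => all (fun m : 'X_{1.. #|{: pvar n}|} =>
    [forall v, (m v != 0%N) ==>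
       E (val (enum_val v)).1 (val (enum_val v)).2]) (msupp f).
Arguments edge_subring K {n} E.

Definition graph_ideal (K : fieldType) (n : nat) (E : rel 'I_n) :
    {pred pring K n} :=
  fun f => (f \in plucker_ideal K n) && (f \in edge_subring K E).
Arguments graph_ideal K {n} E.

Definition plucker_rel (K : fieldType) (n : nat) (i j k l : 'I_n) : pring K n :=
  pl K i j * pl K k l - pl K i k * pl K j l + pl K i l * pl K j k.

Definition graph_plucker_rel (K : fieldType) (n : nat) (E : rel 'I_n)
    (q : pring K n) : Prop :=
  exists i j k l : 'I_n,
    [/\ (i < j)%N, (j < k)%N & (k < l)%N] /\
    [&& E i j, E k l, E i k, E j l, E i l & E j k] /\
    q = plucker_rel K i j k l.
Arguments graph_plucker_rel K {n} E q.

(* f lies in the ideal of the subring A of R generated by X (for X in A): the *)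
(* coefficients are taken in A, not in R.                                     *)
Definition in_ideal_gen (R : comNzRingType) (A : {pred R}) (X : R -> Prop)
    (f : R) : Prop :=
  exists s : seq (R * R),
    (forall u, u \in s -> u.1 \in A /\ X u.2) /\ f = \sum_(u <- s) u.1 * u.2.

(* Main.v *)
Require Import Defs.
From HB Require Import structures.
From mathcomp Require Import all_boot all_order all_fingroup all_algebra.
From mathcomp Require Import ssrcomplements mpoly.
From mathcomp Require Import zify ring.

(** Write [ab] for the signed variable [p_ab], with [ba = - ab]. The Plücker
    relation on four distinct vertices is, up to sign, independent of how they
    are ordered, so the vertices may be reordered at will.

    A graph compatible with the elimination order is, apart from isolated
    vertices, a complete graph together with one further vertex [w] joined to a
    subset [N] of its vertices. Rank the vertices so that [w] comes last and
    [N] just before it. Then whenever [a < b < c < d] in rank and the nested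
    pair [ad], [bc] consists of edges, all six pairs among [a, b, c, d] are
    edges: if [d = w] then [a], hence also [b] and [c], lies in [N]
    ([elim_compatible_order]). This is the only property of the graph that the
    argument uses.

    The theorem is then Hodge's straightening law. In a monomial in the edge
    variables, a nested pair can be rewritten as [ad bc = ac bd - ab cd]; this
    is a Plücker relation of the graph, it stays in the edge subring, and it
    lowers the sum of the squares of the lengths (in rank) of the edges. So
    modulo the ideal generated by the relations every element of the edge
    subring is a combination of monomials without nested pairs
    ([edge_subring_normal_form]).

    Those monomials have linearly independent images in [K[x, y]]: the leading
    monomial of the image of [ab], for [a < b], is [x_a y_b], so the leading
    monomial of the image of a monomial records the multiset of the lower ends
    and that of the upper ends of its edges. For a monomial without nested
    pairs these two multisets, matched in increasing order, give back the edges
    ([content_inj]). Hence the normal form of an element of the Plücker ideal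
    is zero ([nonnesting_independent]). *)

Set Implicit Arguments.
Unset Strict Implicit.
Unset Printing Implicit Defensive.

Import GRing.Theory.
Local Open Scope ring_scope.

(** * Polynomials with restricted support, and ideals of a subring *)

Section SupportIn.
Variables (N : nat) (R : comNzRingType) (P : pred 'X_{1..N}).
Implicit Types f g : {mpoly R[N]}.

Lemma supp_inP f : reflect (forall m, f@_m != 0 -> P m) (all P (msupp f)).
Proof.
apply: (iffP allP) => H m; first by rewrite -mcoeff_msupp; apply: H.
by rewrite mcoeff_msupp; apply: H.
Qed.

Lemma supp_inD f g :
  all P (msupp f) -> all P (msupp g) -> all P (msupp (f + g)).
Proof.
move=> /supp_inP Hf /supp_inP Hg; apply/supp_inP => m.
rewrite mcoeffD; have [f0|/Hf //] := eqVneq (f@_m) 0.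
by rewrite f0 add0r; apply: Hg.
Qed.

Lemma supp_inZ c f : all P (msupp f) -> all P (msupp (c *: f)).
Proof.
move=> /supp_inP Hf; apply/supp_inP => m; rewrite mcoeffZ => H; apply: Hf.
by apply: contraNneq H => ->; rewrite mulr0.
Qed.

Lemma supp_inX m : P m -> all P (msupp ('X_[m] : {mpoly R[N]})).
Proof. by move=> Pm; rewrite msuppX /= Pm. Qed.

Lemma supp_in0 : all P (msupp (0 : {mpoly R[N]})).
Proof. by rewrite msupp0. Qed.

Lemma supp_inM f g :
  (forall m m', P m -> P m' -> P (m + m')%MM) ->
  all P (msupp f) -> all P (msupp g) -> all P (msupp (f * g)).
Proof.
move=> PD /allP Hf /allP Hg; apply/allP => m /msuppM_le /allpairsP.
by case=> -[m1 m2] /= [/Hf H1 /Hg H2 ->]; apply: PD.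
Qed.

End SupportIn.

Section IdealGen.
Variables (R : comNzRingType) (A : {pred R}) (X : R -> Prop).
Local Notation J := (in_ideal_gen A X).

Lemma in_ideal_gen0 : J 0.
Proof. by exists [::]; split=> //; rewrite big_nil. Qed.

Lemma in_ideal_genD f g : J f -> J g -> J (f + g).
Proof.
move=> [s [Hs ->]] [t [Ht ->]]; exists (s ++ t); split; last by rewrite big_cat.
by move=> u; rewrite mem_cat => /orP [/Hs|/Ht].
Qed.

Lemma in_ideal_genM a f :
  (forall b, b \in A -> a * b \in A) -> J f -> J (a * f).
Proof.
move=> Aa [s [Hs ->]]; exists [seq (a * u.1, u.2) | u <- s]; split.
  by move=> u /mapP [v /Hs [Av Xv] ->]; split => //=; apply: Aa.
by rewrite big_map big_distrr /=; apply: eq_bigr => u _; rewrite mulrA.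
Qed.

Lemma in_ideal_gen_id f : 1 \in A -> X f -> J f.
Proof.
move=> A1 Xf; exists [:: (1, f)]; split; last by rewrite big_seq1 mul1r.
by move=> u; rewrite inE => /eqP ->.
Qed.

End IdealGen.

(** * Signed variables and the Plücker relations on unordered vertices *)

(** A property invariant under the three adjacent transpositions need only be
    checked on increasing quadruples: the other orders follow by insertion
    sort. *)
Lemma distinct4_ind (n : nat) (P : 'I_n -> 'I_n -> 'I_n -> 'I_n -> Prop) :
  (forall a b c d : 'I_n, (a < b)%N -> (b < c)%N -> (c < d)%N -> P a b c d) ->
  (forall a b c d, P a b c d -> P b a c d) ->
  (forall a b c d, P a b c d -> P a c b d) ->
  (forall a b c d, P a b c d -> P a b d c) ->
  forall a b c d, uniq [:: a; b; c; d] -> P a b c d.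
Proof.
move=> P0 P12 P23 P34.
have neq (x y : 'I_n) : x != y -> (x < y)%N \/ (y < x)%N.
  by move=> xy; apply/orP; rewrite -neq_ltn.
have H3 (a b c d : 'I_n) : (a < b)%N -> (b < c)%N ->
    a != d -> b != d -> c != d -> P a b c d.
  move=> ab bc /neq [ad|da] /neq [bd|db] /neq [cd|dc]; try lia.
  - exact: P0.
  - by apply/P34/P0.
  - by apply/P34/P23/P0.
  - by apply/P34/P23/P12/P0.
have H2 (a b c d : 'I_n) : (a < b)%N -> a != c -> b != c ->
    a != d -> b != d -> c != d -> P a b c d.
  move=> ab /neq [ac|ca] /neq [bc|cb] ad bd cd; try lia.
  - exact: H3.
  - by apply/P23/H3.
  - by apply/P23/P12/H3.
move=> a b c d /=; rewrite !inE !negb_or.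
case/and4P => /and3P [/neq [ab|ba] ac ad] /andP [bc bd] cd _; first exact: H2.
by apply/P12/H2.
Qed.

Section Brackets.
Variables (K : fieldType) (n : nat).

(** At most one of the two terms is nonzero, so this is [p_ab] when [a < b] and
    [- p_ba] when [b < a]. *)
Definition bracket (a b : 'I_n) : pring K n := pl K a b - pl K b a.

Lemma bracketC a b : bracket b a = - bracket a b.
Proof. by rewrite /bracket opprB. Qed.

Lemma pl0 (a b : 'I_n) : (b <= a)%N -> pl K a b = 0.
Proof. by move=> ba; rewrite /pl insubF //= ltnNge ba. Qed.

Lemma bracket_pl (a b : 'I_n) : (a < b)%N -> bracket a b = pl K a b.
Proof. by move=> ab; rewrite /bracket [pl K b a]pl0 ?subr0 // ltnW. Qed.

Definition bracket_rel (a b c d : 'I_n) : pring K n :=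
  bracket a b * bracket c d - bracket a c * bracket b d
  + bracket a d * bracket b c.

End Brackets.

(** * The edge subring and its ideal of relations *)

Section GraphIdeal.
Variables (K : fieldType) (n : nat) (E : rel 'I_n).
Hypothesis Esym : ssrbool.symmetric E.

Definition ends (v : 'I_#|{: pvar n}|) : 'I_n * 'I_n := val (enum_val v).

Definition on_edges (m : 'X_{1.. #|{: pvar n}|}) : bool :=
  [forall v, (m v != 0%N) ==> E (ends v).1 (ends v).2].

Lemma edge_subringE (f : pring K n) :
  (f \in edge_subring K E) = all on_edges (msupp f).
Proof. by []. Qed.

Lemma on_edgesD m m' : on_edges m -> on_edges m' -> on_edges (m + m')%MM.
Proof.
move=> /forallP H /forallP H'; apply/forallP => v; apply/implyP.
rewrite mnmDE addn_eq0 negb_and => /orP [mv|mv].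
  exact: (implyP (H v)).
exact: (implyP (H' v)).
Qed.

Lemma on_edges1 v : E (ends v).1 (ends v).2 -> on_edges U_(v)%MM.
Proof.
by move=> Ev; apply/forallP => w; apply/implyP; rewrite mnm1E eqb0 negbK => /eqP <-.
Qed.

Lemma edge_subringM (f g : pring K n) : f \in edge_subring K E ->
  g \in edge_subring K E -> f * g \in edge_subring K E.
Proof. by rewrite !edge_subringE; apply: supp_inM; apply: on_edgesD. Qed.

Lemma edge_subringD (f g : pring K n) : f \in edge_subring K E ->
  g \in edge_subring K E -> f + g \in edge_subring K E.
Proof. exact: supp_inD. Qed.

Lemma edge_subringZ c (f : pring K n) : f \in edge_subring K E ->
  c *: f \in edge_subring K E.
Proof. exact: supp_inZ. Qed.

Lemma edge_subring1 : (1 : pring K n) \in edge_subring K E.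
Proof.
by rewrite edge_subringE msupp1 /= andbT; apply/forallP => v; rewrite mnm0E.
Qed.

Lemma pl_var (a b : 'I_n) : (a < b)%N ->
  exists2 v, ends v = (a, b) & pl K a b = 'X_v.
Proof.
move=> ab; exists (enum_rank (Sub (a, b) ab : pvar n)).
  by rewrite /ends enum_rankK SubK.
by rewrite /pl insubT.
Qed.

Lemma edge_subring_pl (a b : 'I_n) : E a b -> pl K a b \in edge_subring K E.
Proof.
move=> Eab; have [ba|ab] := leqP b a; first by rewrite pl0 // edge_subringE msupp0.
have [v ev ->] := pl_var ab; rewrite edge_subringE; apply: supp_inX.
by apply: on_edges1; rewrite ev.
Qed.

Local Notation J := (in_ideal_gen (edge_subring K E) (graph_plucker_rel K E)).

Lemma idealM a f : a \in edge_subring K E -> J f -> J (a * f).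
Proof. by move=> Aa; apply: in_ideal_genM => b; apply: edge_subringM. Qed.

Lemma idealZ c f : J f -> J (c *: f).
Proof.
rewrite -mul_mpolyC; apply: idealM; rewrite -[_%:MP]mulr1 mul_mpolyC.
exact/edge_subringZ/edge_subring1.
Qed.

(** The bracket relation changes sign under each adjacent transposition of its
    arguments, which reduces it to a generator. *)
Lemma ideal_bracket_rel a b c d : uniq [:: a; b; c; d] ->
  E a b -> E a c -> E a d -> E b c -> E b d -> E c d ->
  J (bracket_rel K a b c d).
Proof.
have JN f : J f -> J (- f) by rewrite -scaleN1r; apply: idealZ.
move: a b c d; apply: distinct4_ind.
- move=> a b c d ab bc cd Eab Eac Ead Ebc Ebd Ecd.
  apply: in_ideal_gen_id; first exact: edge_subring1.
  exists a, b, c, d; split=> //; split; first by rewrite Eab Ecd Eac Ebd Ead Ebc.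
  by rewrite /bracket_rel /plucker_rel !bracket_pl //; lia.
- move=> a b c d H Eba Ebc Ebd Eac Ead Ecd.
  rewrite (_ : bracket_rel _ _ _ _ _ = - bracket_rel K a b c d).
    by apply/JN/H => //; rewrite Esym.
  by rewrite /bracket_rel (bracketC K a b); ring.
- move=> a b c d H Eba Ebc Ebd Eac Ead Ecd.
  rewrite (_ : bracket_rel _ _ _ _ _ = - bracket_rel K a b c d).
    by apply/JN/H => //; rewrite Esym.
  by rewrite /bracket_rel (bracketC K b c); ring.
move=> a b c d H Eba Ebc Ebd Eac Ead Ecd.
rewrite (_ : bracket_rel _ _ _ _ _ = - bracket_rel K a b c d).
  by apply/JN/H => //; rewrite Esym.
by rewrite /bracket_rel (bracketC K c d); ring.
Qed.

Lemma plucker_map_pl (a b : 'I_n) : (a < b)%N ->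
  plucker_map (pl K a b) = xvar K a * yvar K b - xvar K b * yvar K a.
Proof.
move=> ab; have [v ev ->] := pl_var ab.
by rewrite /plucker_map mmapX mmap1U -[val _]/(ends v) ev.
Qed.

Lemma plucker_mapD (f g : pring K n) :
  plucker_map (f + g) = plucker_map f + plucker_map g.
Proof. by rewrite /plucker_map rmorphD. Qed.
Lemma plucker_mapB (f g : pring K n) :
  plucker_map (f - g) = plucker_map f - plucker_map g.
Proof. by rewrite /plucker_map rmorphB. Qed.
Lemma plucker_mapM (f g : pring K n) :
  plucker_map (f * g) = plucker_map f * plucker_map g.
Proof. by rewrite /plucker_map rmorphM. Qed.

Lemma plucker_map_rel (i j k l : 'I_n) : (i < j)%N -> (j < k)%N -> (k < l)%N ->
  plucker_map (plucker_rel K i j k l) = 0.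
Proof.
move=> ij jk kl; rewrite /plucker_rel plucker_mapD plucker_mapB.
rewrite (plucker_mapM (pl K i j)) (plucker_mapM (pl K i k)).
rewrite (plucker_mapM (pl K i l)) !plucker_map_pl; try lia.
by ring.
Qed.

Lemma graph_idealE (f : pring K n) : (f \in graph_ideal K E) =
  (plucker_map f == 0) && (f \in edge_subring K E).
Proof. by []. Qed.

Lemma ideal_sub_graph_ideal f : J f -> f \in graph_ideal K E.
Proof.
case=> s [Hs ->]; elim: s Hs => [|u s IH] Hs.
  rewrite big_nil graph_idealE edge_subringE msupp0 andbT.
  by rewrite /plucker_map rmorph0.
have {IH} := IH (fun v Hv => Hs v (@mem_behead _ (u :: s) v Hv)).
have [Au [i [j [k [l [[ij jk kl] [/and5P [Eij Ekl Eik Ejl /andP [Eil Ejk]] eu]]]]]]] :=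
  Hs u (mem_head _ _).
rewrite big_cons !graph_idealE => /andP [/eqP s0 sE]; apply/andP; split.
  by rewrite plucker_mapD plucker_mapM s0 eu plucker_map_rel // mulr0 addr0.
apply: edge_subringD => //; apply: edge_subringM => //; rewrite eu /plucker_rel.
by rewrite -scaleN1r !(edge_subringD, edge_subringZ, edge_subringM, edge_subring_pl).
Qed.

End GraphIdeal.

(** * Straightening for a ranking of the vertices *)

Section Ranking.
Variables (K : fieldType) (n M : nat) (r : 'I_n -> 'I_M).
Hypothesis r_inj : injective r.
Local Notation var := 'I_#|{: pvar n}|.
Local Notation monom := 'X_{1.. #|{: pvar n}|}.

Definition lo (v : var) : 'I_n :=
  if (r (ends v).1 < r (ends v).2)%N then (ends v).1 else (ends v).2.
Definition hi (v : var) : 'I_n :=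
  if (r (ends v).1 < r (ends v).2)%N then (ends v).2 else (ends v).1.

Lemma ends_lt (v : var) : ((ends v).1 < (ends v).2)%N.
Proof. exact: (valP (enum_val v)). Qed.

Lemma ends_inj : injective (@ends n).
Proof. by move=> v w /val_inj /enum_val_inj. Qed.

Lemma rank_neq (a b : 'I_n) : a != b -> (r a < r b)%N || (r b < r a)%N.
Proof. by move=> ab; rewrite -neq_ltn (inj_eq val_inj) (inj_eq r_inj). Qed.

Lemma uniq_rank (a b c d : 'I_n) :
  (r a < r b)%N -> (r b < r c)%N -> (r c < r d)%N -> uniq [:: a; b; c; d].
Proof.
move=> ab bc cd; apply: (@map_uniq _ _ (fun x => val (r x))).
by apply: (sorted_uniq ltn_trans ltnn); rewrite /= ab bc cd.
Qed.

Lemma lo_lt_hi v : (r (lo v) < r (hi v))%N.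
Proof.
rewrite /lo /hi; have := ends_lt v; case: (ends v) => a b /= ab.
by have := @rank_neq a b; case: ifP => //= _ -> //; rewrite -val_eqE neq_ltn ab.
Qed.

Lemma lo_hi_inj v w : lo v = lo w -> hi v = hi w -> v = w.
Proof.
move=> el eh; apply: ends_inj; move: el eh (ends_lt v) (ends_lt w); rewrite /lo /hi.
case: (ends v) (ends w) => [a b] [c d] /=.
by case: ifP => _; case: ifP => _ -> -> //; lia.
Qed.

Lemma bracket_var (a b : 'I_n) : (r a < r b)%N ->
  exists v, [/\ lo v = a, hi v = b
    & exists2 e : K, e * e = 1 & bracket K a b = e *: 'X_v].
Proof.
move=> rab; have [ab|ba|/val_inj ab] := ltngtP a b.
- have [v ev pv] := pl_var K ab; exists v; rewrite /lo /hi ev /= rab; split=> //.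
  by exists 1; rewrite ?mulr1 // scale1r bracket_pl.
- have [v ev pv] := pl_var K ba; exists v; rewrite /lo /hi ev /= ltnNge ltnW //.
  split=> //; exists (-1); first by rewrite mulrNN mulr1.
  by rewrite bracketC bracket_pl // pv scaleN1r.
- by rewrite ab ltnn in rab.
Qed.

(** As [e * e = 1], the scalar is a sign. *)
Lemma var_bracket v :
  exists2 e : K, e * e = 1 & 'X_v = e *: bracket K (lo v) (hi v).
Proof.
have [w [el eh [e e1 ->]]] := bracket_var (lo_lt_hi v).
by exists e => //; rewrite scalerA e1 scale1r (lo_hi_inj el eh).
Qed.

Definition nested (v w : var) : bool :=
  (r (lo v) < r (lo w))%N && (r (hi w) < r (hi v))%N.

Definition nonnesting (m : monom) : bool :=
  [forall v, forall w, (m v != 0%N) && (m w != 0%N) ==> ~~ nested v w].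

(** Squared because for [a < b < c < d] the lengths of [ac], [bd] have the same
    sum as those of the nested pair [ad], [bc]: being closer to each other,
    they have a smaller sum of squares. *)
Definition weight (m : monom) : nat :=
  \sum_v m v * (r (hi v) - r (lo v)) ^ 2.

Lemma weightD m m' : weight (m + m')%MM = (weight m + weight m')%N.
Proof.
by rewrite /weight -big_split /=; apply: eq_bigr => v _; rewrite mnmDE mulnDl.
Qed.

Lemma weight1 v : weight U_(v)%MM = ((r (hi v) - r (lo v)) ^ 2)%N.
Proof.
rewrite /weight (bigD1 v) //= mnm1E eqxx mul1n big1 ?addn0 // => w wv.
by rewrite mnm1E eq_sym (negbTE wv).
Qed.

Variable E : rel 'I_n.
Hypothesis Esym : ssrbool.symmetric E.
Hypothesis nested_clique : forall a b c d : 'I_n,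
  (r a < r b)%N -> (r b < r c)%N -> (r c < r d)%N -> E a d -> E b c ->
  [&& E a b, E a c, E b d & E c d].

Local Notation J := (in_ideal_gen (edge_subring K E) (graph_plucker_rel K E)).

Definition normal (m : monom) : bool := on_edges E m && nonnesting m.

Definition has_normal_form (f : pring K n) : Prop :=
  exists2 g : pring K n, all normal (msupp g) & J (f - g).

Lemma normal_formD f g :
  has_normal_form f -> has_normal_form g -> has_normal_form (f + g).
Proof.
move=> [f' Nf Jf] [g' Ng Jg]; exists (f' + g'); first exact: supp_inD.
by rewrite opprD addrACA; apply: in_ideal_genD.
Qed.

Lemma normal_formZ c f : has_normal_form f -> has_normal_form (c *: f).
Proof.
move=> [f' Nf Jf]; exists (c *: f'); first exact: supp_inZ.
by rewrite -scalerBr; apply: idealZ.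
Qed.

Lemma normal_form_ideal f : J f -> has_normal_form f.
Proof. by move=> Jf; exists 0; rewrite ?subr0 // supp_in0. Qed.

Lemma edge_lo_hi v : E (lo v) (hi v) = E (ends v).1 (ends v).2.
Proof. by rewrite /lo /hi; case: ifP => // _; rewrite Esym. Qed.

Lemma monom_split2 (m : monom) v w : v != w -> m v != 0%N -> m w != 0%N ->
  exists m0, m = (m0 + (U_(v) + U_(w)))%MM.
Proof.
move=> vw mv mw; exists (m - (U_(v) + U_(w)))%MM; rewrite submK //.
apply/mnm_lepP => x; rewrite mnmDE !mnm1E.
have [<-|vx] := eqVneq v x; first by rewrite eq_sym (negbTE vw) addn0 lt0n.
by have [<-|] := eqVneq w x; rewrite //= lt0n.
Qed.

Lemma exchange_lt (a b c d : nat) : (a < b)%N -> (b < c)%N -> (c < d)%N ->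
  ((c - a) ^ 2 + (d - b) ^ 2 < (d - a) ^ 2 + (c - b) ^ 2)%N /\
  ((b - a) ^ 2 + (d - c) ^ 2 < (d - a) ^ 2 + (c - b) ^ 2)%N.
Proof. move=> ab bc cd; split; nia. Qed.

(** Strong induction on the weight. The graph hypothesis enters here: it makes
    the relation that straightens a nested pair a combination of generators,
    and keeps both replacement monomials in the edge subring. *)
Lemma straighten m : on_edges E m -> has_normal_form 'X_[m].
Proof.
have [k] := ubnP (weight m); elim: k m => // k IH m wk Em.
have [Nm|] := boolP (nonnesting m).
  exists 'X_[m]; first by apply: supp_inX; rewrite /normal Em.
  by rewrite subrr; apply: in_ideal_gen0.
rewrite negb_forall => /existsP [v]; rewrite negb_forall => /existsP [w].
rewrite negb_imply negbK => /andP [/andP [mv mw] /andP [ab' cd']].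
have vw : v != w by apply: contraTneq ab' => ->; rewrite ltnn.
have [m0 em] := monom_split2 vw mv mw.
have Ev := implyP (forallP Em v) mv; have Ew := implyP (forallP Em w) mw.
rewrite -edge_lo_hi in Ev; rewrite -edge_lo_hi in Ew.
have bc' := lo_lt_hi w.
have [ev ev1 Xv] := var_bracket v; have [ew ew1 Xw] := var_bracket w.
have wv := weight1 v; have ww := weight1 w.
move: (lo v) (hi v) (lo w) (hi w) => a d b c in Ev Ew ab' cd' bc' Xv Xw wv ww.
have /and4P [Eab Eac Ebd Ecd] := nested_clique ab' bc' cd' Ev Ew.
have [lt1 lt2] := exchange_lt ab' bc' cd'.
have Em0 : on_edges E m0.
  apply/forallP => x; apply/implyP => mx; apply: (implyP (forallP Em x)).
  by rewrite em mnmDE addn_eq0 negb_and mx.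
(* Both replacement monomials are covered by the induction hypothesis. *)
have sub x1 y1 x2 y2 : (r x1 < r y1)%N -> (r x2 < r y2)%N -> E x1 y1 -> E x2 y2 ->
    ((r y1 - r x1) ^ 2 + (r y2 - r x2) ^ 2 < (r d - r a) ^ 2 + (r c - r b) ^ 2)%N ->
    has_normal_form ('X_[m0] * (bracket K x1 y1 * bracket K x2 y2)).
  move=> lt_1 lt_2 E1 E2 lt_w.
  have [v1 [l1 h1 [e1 _ ->]]] := bracket_var lt_1.
  have [v2 [l2 h2 [e2 _ ->]]] := bracket_var lt_2.
  rewrite -scalerAl -!scalerAr -!mpolyXD; do 2 apply: normal_formZ.
  apply: IH.
    move: wk; rewrite em !weightD wv ww (weight1 v1) (weight1 v2) l1 h1 l2 h2 ltnS => wk.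
    by apply: leq_trans wk; rewrite ltn_add2l.
  by apply: on_edgesD => //; apply: on_edgesD; apply: on_edges1;
    rewrite -edge_lo_hi ?l1 ?h1 ?l2 ?h2.
rewrite em !mpolyXD Xv Xw -scalerAl -!scalerAr.
apply: normal_formZ; apply: normal_formZ.
rewrite (_ : _ * _ = 'X_[m0] * bracket_rel K a b c d
   + ('X_[m0] * (bracket K a c * bracket K b d)
      + (-1) *: ('X_[m0] * (bracket K a b * bracket K c d)))); last first.
  by rewrite /bracket_rel scaleN1r; ring.
apply: normal_formD.
  apply: normal_form_ideal; apply: idealM; first exact: supp_inX.
  by apply: ideal_bracket_rel => //; apply: uniq_rank.
apply: normal_formD; last apply: normal_formZ; apply: sub => //.
  exact: ltn_trans bc'.
exact: ltn_trans cd'.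
Qed.

Lemma edge_subring_normal_form f :
  f \in edge_subring K E -> has_normal_form f.
Proof.
move/allP => Hf; rewrite [f]mpolyE big_seq.
apply: (big_ind has_normal_form); last first.
- by move=> m /Hf Em; apply/normal_formZ/straighten.
- exact: normal_formD.
- by apply: normal_form_ideal; apply: in_ideal_gen0.
Qed.

End Ranking.

(** * Nonnesting monomials are determined by their lower and upper ends *)

Section Content.
Variables (n M : nat) (r : 'I_n -> 'I_M).
Hypothesis r_inj : injective r.
Local Notation var := 'I_#|{: pvar n}|.
Local Notation monom := 'X_{1.. #|{: pvar n}|}.

(** The exponent of [x_a y_b], where [a < b] are the ranks of the ends of [v];
    by [mlead_ranked_var] it is the leading exponent of the image of [v]. *)
Definition lead_var (v : var) : 'X_{1.. M + M} :=
  (U_(lshift M (r (lo r v))) + U_(rshift M (r (hi r v))))%MM.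

Definition content (m : monom) : 'X_{1.. M + M} :=
  (\sum_v lead_var v *+ m v)%MM.

Definition mcount (m : monom) (P : pred var) : nat := \sum_v m v * P v.

Lemma content_lo m i : content m (lshift M i) = mcount m (fun v => r (lo r v) == i).
Proof.
rewrite /content mnm_sumE; apply: eq_bigr => v _.
by rewrite mulmnE mnmDE !mnm1E eq_rlshift addn0 (inj_eq (@lshift_inj _ _)) mulnC.
Qed.

Lemma content_hi m i : content m (rshift M i) = mcount m (fun v => r (hi r v) == i).
Proof.
rewrite /content mnm_sumE; apply: eq_bigr => v _.
by rewrite mulmnE mnmDE !mnm1E eq_lrshift (inj_eq (@rshift_inj _ _)) mulnC.
Qed.

Lemma mcount_lt m (f : var -> 'I_M) (k : nat) :
  mcount m (fun v => f v < k)%N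
  = \sum_(i < M | (i < k)%N) mcount m (fun v => f v == i).
Proof.
rewrite exchange_big; apply: eq_bigr => v _ /=.
rewrite -big_distrr /=; congr muln; rewrite big_mkcond (bigD1 (f v)) //= eqxx.
rewrite big1 => [|i /negbTE vi]; first by case: ltnP.
by rewrite eq_sym vi if_same.
Qed.

(** If some edge has its lower end below [a] and its upper end at or above [b],
    then every edge with upper end below [b] has its lower end below [a], lest
    the two be nested. So one of the two conditions implies the other on all
    edges of [m], and the smaller count is that of the conjunction. *)
Lemma mcount_box (m : monom) (a b : nat) : nonnesting r m ->
  mcount m (fun v => (r (lo r v) < a)%N && (r (hi r v) < b)%N)
  = minn (mcount m (fun v => r (lo r v) < a)%N)
         (mcount m (fun v => r (hi r v) < b)%N).
Proof.
move=> Nm; pose Pv v := [&& m v != 0%N, (r (lo r v) < a)%N & (b <= r (hi r v))%N].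
have [/existsP [v /and3P [mv va vb]]|none] := boolP [exists v, Pv v].
  rewrite (_ : mcount m (fun v => r (hi r v) < b)%N =
    mcount m (fun v => (r (lo r v) < a)%N && (r (hi r v) < b)%N)).
    by apply/esym/minn_idPr/leq_sum => w _; case: leqP => //=; lia.
  apply: eq_bigr => w _; have [->|mw] := eqVneq (m w) 0%N; first by rewrite !mul0n.
  have := implyP (forallP (forallP Nm v) w); rewrite mv mw /nested.
  by move/(_ isT) => nvw; congr muln; lia.
rewrite (_ : mcount m (fun v => r (lo r v) < a)%N =
    mcount m (fun v => (r (lo r v) < a)%N && (r (hi r v) < b)%N)).
  by apply/esym/minn_idPl/leq_sum => w _; rewrite leq_mul2l; lia.
apply: eq_bigr => w _; have [->|mw] := eqVneq (m w) 0%N; first by rewrite !mul0n.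
have: ~~ Pv w by apply: contra none => Pw; apply/existsP; exists w.
by rewrite /Pv mw /= => H; congr muln; lia.
Qed.

(** Inclusion-exclusion: the multiplicity of one edge is the mixed second
    difference of the box counts, as no two variables have the same ends. *)
Lemma mcount_var (m : monom) v :
  let N a b := mcount m (fun w => (r (lo r w) < a)%N && (r (hi r w) < b)%N) in
  let a := r (lo r v) : nat in let b := r (hi r v) : nat in
  (m v + N a.+1 b + N a b.+1 = N a.+1 b.+1 + N a b)%N.
Proof.
move=> N a b; rewrite (_ : m v = mcount m (pred1 v)); last first.
  rewrite /mcount (bigD1 v) //= eqxx muln1 big1 ?addn0 // => w.
  by move/negbTE ->; rewrite muln0.
rewrite /N /mcount -!big_split /=; apply: eq_bigr => w _.
rewrite -!mulnDr; congr muln.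
have -> : (w == v) = (r (lo r w) == a :> nat) && (r (hi r w) == b :> nat).
  apply/eqP/andP => [->//|[/eqP ea /eqP eb]].
  by apply: (lo_hi_inj (r := r)); apply/r_inj/val_inj.
by rewrite !ltnS; case: (ltngtP (r (lo r w)) a); case: (ltngtP (r (hi r w)) b).
Qed.

Lemma content_inj m m' : nonnesting r m -> nonnesting r m' ->
  content m = content m' -> m = m'.
Proof.
move=> Nm Nm' e; apply/mnmP => v.
have box a b : mcount m (fun w => (r (lo r w) < a)%N && (r (hi r w) < b)%N)
             = mcount m' (fun w => (r (lo r w) < a)%N && (r (hi r w) < b)%N).
  rewrite !mcount_box //; congr minn; rewrite !mcount_lt; apply: eq_bigr => i _.
    by rewrite -!content_lo e.
  by rewrite -!content_hi e.
have := mcount_var m v; rewrite /= !box -(mcount_var m' v) /=; lia.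
Qed.

End Content.

(** * Independence of the nonnesting monomials *)

Section Independence.
Variables (K : fieldType) (n M : nat) (r : 'I_n -> 'I_M).
Hypothesis r_inj : injective r.

(** Renumbers the [x_a] and [y_b] by rank. After this the degree-lexicographic
    order, in which variables of smaller index are larger, prefers [x_a y_b] to
    [x_b y_a] exactly when [a] ranks below [b]. *)
Definition rank_map : {mpoly K[n + n]} -> {mpoly K[M + M]} :=
  mmap (@mpolyC (M + M) K) (fun z => match split z with
    | inl a => 'X_(lshift M (r a)) | inr b => 'X_(rshift M (r b)) end).

Definition ranked_plucker_map (f : pring K n) : {mpoly K[M + M]} :=
  rank_map (plucker_map f).

(* Convertible to a composite of two evaluation morphisms. *)
HB.instance Definition _ := GRing.RMorphism.copy ranked_plucker_map
  (mmap (@mpolyC (M + M) K) (fun z => match split z with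
    | inl a => 'X_(lshift M (r a)) | inr b => 'X_(rshift M (r b)) end) \o
   mmap (@mpolyC (n + n) K)
    (fun v => let: (i, j) := val (enum_val v) in
       xvar K i * yvar K j - xvar K j * yvar K i)).

Lemma ranked_plucker_mapZ c f :
  ranked_plucker_map (c *: f) = c *: ranked_plucker_map f.
Proof.
rewrite /ranked_plucker_map /plucker_map mmapZ /rank_map rmorphM /= mmapC.
by rewrite mul_mpolyC.
Qed.

Lemma ranked_bracket a b : ranked_plucker_map (bracket K a b) =
  'X_(lshift M (r a)) * 'X_(rshift M (r b)) - 'X_(lshift M (r b)) * 'X_(rshift M (r a)).
Proof.
wlog ab: a b / (a < b)%N => [H|].
  have [ab|ba|/val_inj ->] := ltngtP a b; first exact: H.
    by rewrite bracketC rmorphN /= H // opprB.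
  by rewrite /bracket !subrr rmorph0.
rewrite bracket_pl // /ranked_plucker_map plucker_map_pl // /rank_map.
rewrite rmorphB !rmorphM /= !mmapX !mmap1U.
by rewrite !(unsplitK (inl _)) !(unsplitK (inr _)).
Qed.

Lemma mlead_ranked_var v : ranked_plucker_map 'X_v != 0 /\
  mlead (ranked_plucker_map 'X_v) = lead_var r v.
Proof.
have [e e1 ->] := var_bracket K r_inj v; have ab := lo_lt_hi r_inj v.
have e0 : e != 0 by apply: contra_eqN e1 => /eqP ->; rewrite mul0r eq_sym oner_eq0.
rewrite ranked_plucker_mapZ ranked_bracket.
rewrite /lead_var mleadZ // scaler_eq0 negb_or e0 /=.
move: (r (lo r v)) (r (hi r v)) ab => a b ab.
rewrite -!mpolyXD.
have lt : ((U_(lshift M b) + U_(rshift M a) : 'X_{1..M+M})%MM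
           < (U_(lshift M a) + U_(rshift M b))%MM)%O.
  apply/ltmcP; first by rewrite !mdegD !mdeg1.
  exists (lshift M a) => [j /= ja|].
    by move: ja (ltn_ord b); rewrite !mnmDE !mnm1E -!val_eqE /=; lia.
  by move: (ltn_ord b); rewrite !mnmDE !mnm1E -!val_eqE /=; lia.
have lead : mlead ('X_[U_(lshift M a) + U_(rshift M b)]
   - 'X_[U_(lshift M b) + U_(rshift M a)] : {mpoly K[M + M]})
   = (U_(lshift M a) + U_(rshift M b))%MM.
  by rewrite mleadDl ?mleadN !mleadXm.
split=> //; rewrite -mleadc_eq0 lead mcoeffB !mcoeffX eqxx.
rewrite (Order.POrderTheory.lt_eqF lt) subr0.
exact: oner_neq0.
Qed.

Lemma mlead_ranked_monom m : ranked_plucker_map 'X_[m] != 0 /\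
  mlead (ranked_plucker_map 'X_[m]) = content r m.
Proof.
have nz v : ranked_plucker_map 'X_v ^+ m v != 0.
  by apply: expf_neq0; have [] := mlead_ranked_var v.
have -> : ranked_plucker_map 'X_[m] = \prod_v ranked_plucker_map 'X_v ^+ m v.
  by rewrite mpolyXE_id rmorph_prod; apply: eq_bigr => v _; rewrite rmorphXn.
split; first by apply/prodf_neq0 => v _.
rewrite mlead_prod //; apply: eq_bigr => v _.
by have [v0 lv] := mlead_ranked_var v; rewrite mleadX // lv.
Qed.

(** Among the monomials of [g], the one of largest content contributes its
    leading term to the image of [g], and by [content_inj] nothing else
    reaches that exponent. *)
Lemma nonnesting_independent (g : pring K n) :
  all (nonnesting r) (msupp g) -> plucker_map g = 0 -> g = 0.
Proof.
move=> /allP Ng g0; apply/eqP; rewrite -msupp_eq0; apply: contraT => gn0.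
have [m mg mmax] : exists2 m, m \in msupp g &
    forall m', m' \in msupp g -> (content r m' <= content r m)%O.
  have mmax m' : m' \in msupp g ->
      (content r m' <= \join_(i <- msupp g) content r i)%O.
    by move=> H; apply: Order.BJoinTheory.joins_sup_seq.
  case: bigjoinP mmax => [||m mg mmax]; last by exists m.
    exact: Order.TotalTheory.le_total.
  by rewrite /nilp size_eq0 (negbTE gn0).
have : (ranked_plucker_map g)@_(content r m) = 0.
  by rewrite /ranked_plucker_map g0 /rank_map rmorph0 mcoeff0.
rewrite {1}[g]mpolyE rmorph_sum raddf_sum (bigD1_seq m) ?msupp_uniq //=.
rewrite big_seq_cond big1 => [|m' /andP [m'g m'm]].
  rewrite addr0 ranked_plucker_mapZ mcoeffZ => /eqP; rewrite mulf_eq0.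
  have [n0 <-] := mlead_ranked_monom m; rewrite mleadc_eq0 (negbTE n0) orbF.
  by rewrite mcoeff_eq0 mg.
rewrite ranked_plucker_mapZ mcoeffZ [X in _ * X]mcoeff_gt_mlead ?mulr0 //.
have [_ ->] := mlead_ranked_monom m'; rewrite Order.POrderTheory.lt_neqAle mmax // andbT.
by apply: contra m'm => /eqP /(content_inj r_inj (Ng _ m'g) (Ng _ mg)) ->.
Qed.

End Independence.

(** * Generation by quadrics *)

(** An element of [I_G] is congruent, modulo the ideal generated by the
    relations, to a nonnesting normal form; the latter is again in the Plücker
    ideal, hence zero by independence. *)
Lemma graph_ideal_generated (K : fieldType) (n M : nat) (r : 'I_n -> 'I_M)
  (E : rel 'I_n) :
  injective r -> ssrbool.symmetric E ->
  (forall a b c d : 'I_n,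
    (r a < r b)%N -> (r b < r c)%N -> (r c < r d)%N -> E a d -> E b c ->
    [&& E a b, E a c, E b d & E c d]) ->
  forall f : pring K n, f \in graph_ideal K E ->
    in_ideal_gen (edge_subring K E) (graph_plucker_rel K E) f.
Proof.
move=> r_inj Esym Eclique f; rewrite graph_idealE => /andP [/eqP f0 fE].
have [g Ng Jfg] := edge_subring_normal_form r_inj Esym Eclique fE.
suff g0 : g = 0 by rewrite g0 subr0 in Jfg.
apply: (nonnesting_independent r_inj).
  by apply: sub_all Ng => m /andP [].
have := ideal_sub_graph_ideal Jfg; rewrite graph_idealE plucker_mapB f0 sub0r.
by rewrite oppr_eq0 => /andP [/eqP].
Qed.

(** In the coordinates of the isomorphism [s], the vertices below [j] are
    isolated, those above [j] form a complete graph, and [j] is joined exactly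
    to those above [k]. Keeping the order and moving [j] to the end (rank [n])
    makes the neighbours of [j] the last vertices before it. *)
Lemma elim_compatible_order (n : nat) (E : rel 'I_n) :
  irreflexive E -> elim_compatible E ->
  exists2 r : 'I_n -> 'I_n.+1, injective r & forall a b c d : 'I_n,
    (r a < r b)%N -> (r b < r c)%N -> (r c < r d)%N -> E a d -> E b c ->
    [&& E a b, E a c, E b d & E c d].
Proof.
move=> Eirr [j [k [jk [s Es]]]].
pose r a : 'I_n.+1 := if s a == j then ord_max else widen_ord (leqnSn n) (s a).
have rE a : (r a = (if s a == j :> nat then n else s a) :> nat).
  by rewrite /r val_eqE; case: ifP.
have EE a b : E a b = (s a != s b :> nat) && ~~ (segment_graph j k (s a) (s b)).
  rewrite -Es /compl_graph val_eqE (inj_eq perm_inj) negb_and !negbK.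
  by have [->|] := eqVneq a b; rewrite ?Eirr.
exists r => [a b|a b c d].
  move/(congr1 (@nat_of_ord _)); rewrite !rE => rab.
  apply: (@perm_inj _ s); apply: val_inj => /=.
  by move: rab (ltn_ord (s a)) (ltn_ord (s b)); do 2 case: eqP; lia.
rewrite !rE !EE /segment_graph /in_segment -!val_eqE /=.
move: (ltn_ord (s a)) (ltn_ord (s b)) (ltn_ord (s c)) (ltn_ord (s d)) jk.
move: (s a : nat) (s b : nat) (s c : nat) (s d : nat) (j : nat) (k : nat).
clear; move=> a b c d j k; do 4 case: eqP => ?; lia.
Qed.

Theorem corollaryA6 (K : fieldType) (n : nat) (E : rel 'I_n)
    (Esym : ssrbool.symmetric E) (Eirr : irreflexive E) (Ecomp : elim_compatible E) :
  forall f : pring K n,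
    f \in graph_ideal K E <->
    in_ideal_gen (edge_subring K E) (graph_plucker_rel K E) f.
Proof.
move=> f; split; last exact: ideal_sub_graph_ideal.
have [r r_inj Eclique] := elim_compatible_order Eirr Ecomp.
exact: (graph_ideal_generated r_inj Esym Eclique).
Qed.
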